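(* Let $p\geq 7$ be a prime with $p\equiv \pm 5\pmod{12}$ and let $n=2\left[\frac{p}{4}\right]$, where $[a]$ denotes the integer closest to $a$. Then there exists a linear $2$-quasi-perfect Lee code $\mathcal C\subseteq \mathbb Z_p^n$ with exactly $p^{n-2}$ codewords.
   Context: $\mathbb Z_p=\mathbb Z/p\mathbb Z$. The Lee distance on $\mathbb Z_p^n$ is $d(v,w)=\sum_{j=1}^n \min\{|s| : s\in\mathbb Z,\ s\equiv v_j-w_j \pmod p\}$. A (Lee) code is a subset $\mathcal C\subseteq\mathbb Z_p^n$, considered with the Lee distance; it is linear if it is a subgroup of $\mathbb Z_p^n$. The error correction of $\mathcal C$ is the greatest integer $t$ such that for every word $w\in\mathbb Z_p^n$ there is at most one $c\in\mathcal C$ with $d(w,c)\le t$; then $\mathcal C$ is called $t$-error correcting. The covering radius of $\mathcal C$ is the smallest integer $r$ such that for every word $w$ there is at least one $c\in\mathcal C$ with $d(w,c)\le r$; then $\mathcal C$ is called $r$-covering. A code is $t$-quasi-perfect if it is $t$-error correcting and $(t+1)$-covering. *)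

(* Defs.v *)
From mathcomp Require Import all_boot all_order all_algebra.
Set Implicit Arguments. Unset Strict Implicit. Unset Printing Implicit Defensive.
Import Order.TTheory GRing.Theory Num.Theory.
Local Open Scope ring_scope.

(* For prime p, Z/pZ is 'F_p, and the congruence of the integer s to x : 'F_p
   reads s%:~R = x. *)
Definition has_rep (p : nat) (x : 'F_p) : pred nat :=
  fun k => has (fun s : int => s%:~R == x) [:: k%:Z; - k%:Z].

Lemma has_repP (p : nat) (x : 'F_p) (k : nat) :
  reflect (exists2 s : int, s%:~R = x & `|s|%N = k) (has_rep x k).
Proof.
apply: (iffP hasP) => [[s + /eqP <-]|[s <- <-]].
  by rewrite !inE => /orP[] /eqP->; eexists=> //; rewrite ?abszN absz_nat.
exists s => //; rewrite !inE; case: s => m; first by rewrite absz_nat eqxx.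
by rewrite NegzE abszN absz_nat eqxx orbT.
Qed.

Lemma has_rep_ex (p : nat) (x : 'F_p) : exists k, has_rep x k.
Proof.
by exists x; apply/has_repP; exists x%:Z => //; rewrite -pmulrn natr_Zp.
Qed.

(* min {|s| : s integer, s congruent to x} *)
Definition lee_weight (p : nat) (x : 'F_p) : nat := ex_minn (has_rep_ex x).

Definition lee_dist (p n : nat) (v w : 'rV['F_p]_n) : nat :=
  (\sum_(j < n) lee_weight (v 0 j - w 0 j)%R)%N.

Definition linear_code (p n : nat) (C : {set 'rV['F_p]_n}) : Prop :=
  zmod_closed (mem C).

Definition corrects (p n : nat) (C : {set 'rV['F_p]_n}) (t : nat) : Prop :=
  forall w c c' : 'rV['F_p]_n, c \in C -> c' \in C ->
    (lee_dist w c <= t)%N -> (lee_dist w c' <= t)%N -> c = c'.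

Definition covers (p n : nat) (C : {set 'rV['F_p]_n}) (r : nat) : Prop :=
  forall w : 'rV['F_p]_n, exists2 c, c \in C & (lee_dist w c <= r)%N.

(* t is exactly the error correction of C, not merely a lower bound for it. *)
Definition error_correcting (p n : nat) (C : {set 'rV['F_p]_n}) (t : nat) : Prop :=
  corrects C t /\ forall t' : nat, corrects C t' -> (t' <= t)%N.

(* r is exactly the covering radius of C. *)
Definition covering (p n : nat) (C : {set 'rV['F_p]_n}) (r : nat) : Prop :=
  covers C r /\ forall r' : nat, covers C r' -> (r <= r')%N.

Definition quasi_perfect (p n : nat) (C : {set 'rV['F_p]_n}) (t : nat) : Prop :=
  error_correcting C t /\ covering C t.+1.

Definition closest_int (a : rat) (m : int) : Prop :=
  forall k : int, `|a - m%:~R| <= `|a - k%:~R|.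

(* Main.v *)
Require Import Defs.
From mathcomp Require Import all_boot all_order all_algebra.
From mathcomp Require Import all_field all_character.
From mathcomp Require Import ring zify.
Set Implicit Arguments. Unset Strict Implicit. Unset Printing Implicit Defensive.
Import Order.TTheory GRing.Theory Num.Theory.
Local Open Scope ring_scope.

(* The code is the kernel of a 2 x n matrix over F_p whose columns represent, up
   to sign, the 2n points of a conic U: the circle x^2 + y^2 = 1 if p = 7 mod 12,
   and its split form x y = 1 if p = 5 mod 12. A word of Lee weight at most k has
   as syndrome a sum of at most k points of U. Two points of the conic are
   determined by their nonzero sum, and no sum of two points is on U because 3 is
   not a square; hence the code corrects two errors. That every vector is a sum
   of three points of U amounts to finding a point on an auxiliary curve of genus
   one. If p = 7 mod 12, counting the squares taken by the two quadratics that
   define this curve is enough. If p = 5 mod 12, the curve has the form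
   y^2 = x (x^2 + a x + b) and 6 points that are of no use. It cannot be that
   there are no others: in the second moment of the traces over all (a, b), the
   scaling orbits of the curve and of its 2-isogenous curve would already
   contribute too much. *)

(** * The quadratic character *)

Section QuadraticCharacter.
Variable F : finFieldType.
Implicit Types a b c d x y z N : F.

Definition is_square x := [exists y : F, y ^+ 2 == x].

Definition chi x : int := if x == 0 then 0 else if is_square x then 1 else -1.

Lemma is_squareP x : reflect (exists y, x = y ^+ 2) (is_square x).
Proof. by apply: (iffP existsP) => [[y /eqP]|[y ->]]; exists y. Qed.

Lemma chi0 : chi 0 = 0.
Proof. by rewrite /chi eqxx. Qed.

Lemma chi_sqr x : x != 0 -> chi x ^+ 2 = 1.
Proof. by rewrite /chi => /negPf ->; case: is_square; rewrite ?sqrrN expr1n. Qed.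

Lemma chi_le1 x : chi x <= 1.
Proof. by rewrite /chi; case: (x =P 0) => // _; case: is_square. Qed.

Lemma chi_square x : x != 0 -> is_square x -> chi x = 1.
Proof. by rewrite /chi => /negPf -> ->. Qed.

Lemma chi_sqr1 x : x != 0 -> chi (x ^+ 2) = 1.
Proof.
by move=> x0; apply: chi_square; [rewrite sqrf_eq0|apply/is_squareP; exists x].
Qed.

Lemma chi_nonsquare x : (chi x == -1) = ~~ is_square x.
Proof.
rewrite /chi; case: (x =P 0) => [->|_]; last by case: is_square.
by apply/esym/negbF/is_squareP; exists 0; rewrite expr0n.
Qed.

Lemma chi_neqN1 x : chi x != - 1 -> exists y, x = y ^+ 2.
Proof. by rewrite chi_nonsquare negbK => /is_squareP. Qed.

Lemma chi_eqN1 x y : chi x = - 1 -> x = y ^+ 2 -> False.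
Proof.
by move=> /eqP; rewrite chi_nonsquare => /is_squareP h xy; apply: h; exists y.
Qed.

Hypothesis two_neq0 : (2 : F) != 0.

(** Turns point counts into character sums: each fibre of a squaring map contributes [1 + chi z]. *)
Lemma card_sqrt z : (#|[set y : F | y ^+ 2 == z]|%:Z = 1 + chi z).
Proof.
rewrite /chi; case: (eqVneq z 0) => [->|z0].
  rewrite [X in #|pred_of_set X|](_ : _ = [set 0]) ?cards1 //.
  by apply/setP=> y; rewrite !inE sqrf_eq0.
case: ifP => [/is_squareP [y zy]|nsq].
  have y0 : y != 0 by apply: contraNneq z0 => y0; rewrite zy y0 expr0n.
  rewrite [X in #|pred_of_set X|](_ : _ = [set y; - y]).
    rewrite cards2 -addr_eq0 -mulr2n -mulr_natl mulf_eq0 (negPf y0).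
    by rewrite (negPf two_neq0).
  by apply/setP=> x; rewrite !inE zy eqf_sqr.
rewrite [X in #|pred_of_set X|](_ : _ = set0) ?cards0 //.
by apply/setP=> x; rewrite !inE; apply: contraFF nsq => /eqP <-; apply/is_squareP; exists x.
Qed.

Lemma sum_card_fiber (I J : finType) (f : I -> J) (A : {set I}) :
  \sum_(z : J) (#|[set y in A | f y == z]|%:Z) = #|A|%:Z.
Proof.
rewrite -sum1_card (partition_big f predT) //= (big_morph Posz PoszD (erefl _)).
by apply: eq_bigr => z _; rewrite -sum1_card; congr (_%:Z); apply: eq_bigl => y; rewrite inE.
Qed.

(** Fibering [F] over squaring writes [#|F|] as the sum of [1 + chi z]. *)
Lemma sum_chi : \sum_z chi z = 0.
Proof.
have := sum_card_fiber (fun y => y ^+ 2) [set: F].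
rewrite cardsT (eq_bigr (fun z => 1 + chi z)) => [|z _]; last first.
  by rewrite -card_sqrt; congr (_%:Z); apply: eq_card => y; rewrite !inE.
rewrite big_split /= sumr_const natz => /eqP.
by rewrite -subr_eq0 addrAC subrr add0r => /eqP.
Qed.

Lemma sum_chi_inj (f : F -> F) : injective f -> \sum_x chi (f x) = 0.
Proof. by move=> fI; rewrite -[RHS]sum_chi [RHS](reindex_inj fI). Qed.

Lemma chiM x y : chi (x * y) = chi x * chi y.
Proof.
have [->|x0] := eqVneq x 0; first by rewrite mul0r chi0 mul0r.
have [->|y0] := eqVneq y 0; first by rewrite mulr0 chi0 mulr0.
have sqM z t : is_square z -> is_square t -> is_square (z * t).
  move=> /is_squareP [u ->] /is_squareP [v ->]; apply/is_squareP.
  by exists (u * v); rewrite exprMn.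
have sqV z : is_square z -> is_square z^-1.
  by move=> /is_squareP [u ->]; apply/is_squareP; exists u^-1; rewrite exprVn.
have sqx z t : z != 0 -> is_square z -> is_square (z * t) = is_square t.
  move=> z0 zs; apply/idP/idP=> [h|]; last exact: sqM.
  by rewrite -[t](mulKf z0) sqM // sqV.
case xs: (is_square x).
  by rewrite /chi mulf_eq0 (negPf x0) (negPf y0) /= sqx // xs mul1r.
case ys: (is_square y).
  by rewrite /chi mulf_eq0 (negPf x0) (negPf y0) /= mulrC sqx // xs ys.
(* The sum over z of chi z + chi (x * z) vanishes and none of its terms is positive. *)
have term z : chi z + chi (x * z) <= 0.
  have [->|z0] := eqVneq z 0; first by rewrite mulr0 chi0.
  rewrite /chi mulf_eq0 (negPf x0) (negPf z0) /=.
  case zs: (is_square z); last by case: ifP.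
  by rewrite mulrC sqx // xs.
have tot : \sum_z (- (chi z + chi (x * z))) = 0.
  rewrite sumrN big_split /= sum_chi add0r.
  by rewrite (sum_chi_inj (mulfI x0)) oppr0.
have term' z : true -> 0 <= - (chi z + chi (x * z)) by rewrite oppr_ge0.
have /eqP := psumr_eq0P term' tot (erefl : xpredT y).
rewrite oppr_eq0 addr_eq0 => /eqP h; rewrite -[LHS]opprK -h.
by rewrite /chi (negPf x0) (negPf y0) xs ys.
Qed.

Lemma chiX2M x y : x != 0 -> chi (x ^+ 2 * y) = chi y.
Proof. by move=> x0; rewrite chiM chi_sqr1 // mul1r. Qed.

(** * Point counts on conics *)

Lemma card_hyperbola c : c != 0 ->
  #|[set z : F * F | z.1 * z.2 == c]| = #|F|.-1.
Proof.
move=> c0; pose f x : F * F := (x, c / x).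
have fI : injective f by move=> x y [].
rewrite [X in #|pred_of_set X|](_ : _ = f @: [set~ 0]) ?card_imset ?cardsC1 //.
apply/setP=> -[x y]; rewrite inE /=; apply/eqP/imsetP => [xy|[z]]; last first.
  by rewrite !inE => z0 [-> ->]; rewrite mulrC divfK.
have x0 : x != 0 by apply: contraNneq c0 => x0; rewrite -xy x0 mul0r.
by exists x; rewrite ?inE // /f -xy mulrC mulKf.
Qed.

(** In the coordinates [x - y], [x + y] the conic [x^2 - y^2 = c] is a hyperbola with [#|F| - 1]
    points; fibering it over [x] gives [#|F|] plus the sum. *)
Lemma sum_chi_conic c : c != 0 -> \sum_x chi (x ^+ 2 - c) = -1.
Proof.
move=> c0; have := sum_card_fiber fst [set z : F * F | z.1 ^+ 2 - z.2 ^+ 2 == c].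
have -> : #|[set z : F * F | z.1 ^+ 2 - z.2 ^+ 2 == c]| = #|F|.-1.
  rewrite -(card_hyperbola c0); pose f (z : F * F) := (z.1 - z.2, z.1 + z.2).
  have fI : injective f.
    move=> [x y] [z t] [h1 h2]; have /(mulfI two_neq0) e : 2 * x = 2 * z.
      have -> : 2 * x = (x - y) + (x + y) by ring.
      by rewrite h1 h2; ring.
    by move: h2; rewrite e => /addrI ->.
  rewrite -(card_imset _ fI); apply: eq_card => -[x y].
  rewrite [RHS]inE /=; apply/imsetP/eqP => [[[z t]]|xy].
    by rewrite inE /= => /eqP <- [-> ->]; ring.
  exists ((x + y) / 2, (y - x) / 2); last by rewrite /f /=; congr pair; field.
  by rewrite inE /= -xy; apply/eqP; field.
rewrite (eq_bigr (fun x => 1 + chi (x ^+ 2 - c))) => [|x _]; last first.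
  have pI : injective (pair x : F -> F * F) by move=> y z [].
  rewrite -card_sqrt -(card_imset _ pI).
  congr (_%:Z); apply: eq_card => -[z y]; rewrite !inE /=; apply/andP/imsetP.
    move=> [/eqP h /eqP zx]; rewrite zx in h *; exists y => //.
    by rewrite inE -h opprB addrC subrK.
  by move=> [t]; rewrite inE => /eqP h [-> ->]; split=> //; rewrite h opprB addrC subrK.
rewrite big_split /= sumr_const natz => /eqP.
have : (0 < #|F|)%N by apply/card_gt0P; exists 0.
by case: #|F| (\sum_i _) => // q S _ /=; rewrite intS => /eqP; lia.
Qed.

(** * Frobenius traces, up to sign, of the curves y^2 = x (x^2 + a x + b) *)

Definition cubic_sum a b : int := \sum_x chi (x * (x ^+ 2 + a * x + b)).

(** Quadratic twist: substituting [d x] for [x] pulls out [d^3], which is [d] up to a square. *)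
Lemma cubic_sum_scale a b d : d != 0 -> cubic_sum (d * a) (d ^+ 2 * b) = chi d * cubic_sum a b.
Proof.
move=> d0; rewrite /cubic_sum (reindex_inj (mulfI d0)) mulr_sumr.
apply: eq_bigr => x _ /=.
have -> : d * x * ((d * x) ^+ 2 + d * a * (d * x) + d ^+ 2 * b)
  = d ^+ 2 * (d * (x * (x ^+ 2 + a * x + b))) by ring.
by rewrite chiX2M // chiM.
Qed.

(* Fibering over u = x + b / x, whose fibre has 1 + chi (u ^ 2 - 4 b) points. *)
Lemma cubic_sum_isogeny a b : b != 0 -> cubic_sum (- 2 * a) (a ^+ 2 - 4 * b) = cubic_sum a b.
Proof.
move=> b0; rewrite [RHS]/cubic_sum (bigD1 0) //= mul0r chi0 add0r.
rewrite (eq_bigr (fun x => chi (x + b / x + a))) => [|x x0]; last first.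
  rewrite -(chiX2M (x + b / x + a) x0); congr chi; by field.
rewrite (partition_big (fun x => x + b / x) predT) //=.
have fiber u : \sum_(x | (x != 0) && (x + b / x == u)) chi (x + b / x + a)
   = chi (u + a) * (1 + chi (u ^+ 2 - 4 * b)).
  rewrite (eq_bigr (fun=> chi (u + a))) => [|x /andP[_ /eqP ->] //].
  rewrite sumr_const -card_sqrt -[LHS]mulr_natr natz; congr (_ * _%:Z).
  (* Completing the square: roots [x] of [x^2 - u x + b] correspond to square roots [2 x - u] of its
     discriminant. *)
  have fI : injective (fun x : F => 2 * x - u) by move=> x y /addIr /(mulfI two_neq0).
  rewrite -[LHS](card_imset _ fI); apply: eq_card => y; rewrite [RHS]inE; apply/imsetP/eqP.
    by move=> [x /andP[x0 /eqP <-] ->]; field.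
  move=> yu; exists ((y + u) / 2); last by field.
  have h : (y + u) / 2 * (u - (y + u) / 2) = b.
    have -> : (y + u) / 2 * (u - (y + u) / 2) = (u ^+ 2 - y ^+ 2) / 4.
      field; by rewrite -[4]/(2 * 2)%:R natrM mulf_neq0.
    rewrite yu; field; by rewrite -[4]/(2 * 2)%:R natrM mulf_neq0.
  have x0 : (y + u) / 2 != 0 by apply: contraNneq b0 => x0; rewrite -h x0 mul0r.
  apply/andP; split=> //; move: h x0; set x := (y + u) / 2 => <- x0.
  by rewrite mulrAC mulfV // mul1r addrC subrK.
rewrite (eq_bigr _ (fun u _ => fiber u)).
under eq_bigr => u _ do rewrite mulrDr mulr1.
rewrite big_split /= [X in _ = X + _](sum_chi_inj (addIr a)) add0r.
(* At [u + a] the quadratic factor of the isogenous curve becomes [u^2 - 4 b]. *)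
rewrite /cubic_sum [LHS](reindex_inj (addIr a)); apply: eq_bigr => u _ /=.
by rewrite -chiM; congr chi; ring.
Qed.

(** Expand the square over pairs [x], [y]. For [x != y] the values of the two quadratics vary
    independently with [(a, b)] and cancel; each nonzero diagonal [x] contributes
    [#|F| (#|F| - 1)]. *)
Lemma cubic_sum_moment : \sum_a \sum_b cubic_sum a b ^+ 2 = #|F|%:Z * #|F|.-1%:Z ^+ 2.
Proof.
pose g x y a b := chi (x ^+ 2 + a * x + b) * chi (y ^+ 2 + a * y + b).
have expand : \sum_a \sum_b cubic_sum a b ^+ 2
    = \sum_x \sum_y chi (x * y) * \sum_a \sum_b g x y a b.
  under eq_bigr => a _.
    under eq_bigr => b _ do rewrite expr2 /cubic_sum big_distrlr /=.
    rewrite exchange_big /=.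
    under eq_bigr => x _ do rewrite exchange_big /=.
    over.
  rewrite exchange_big; apply: eq_bigr => x _ /=.
  rewrite exchange_big; apply: eq_bigr => y _ /=.
  rewrite mulr_sumr; apply: eq_bigr => a _; rewrite mulr_sumr.
  apply: eq_bigr => b _; rewrite /g !chiM; ring.
rewrite expand (bigD1 0) //= big1 ?add0r => [|y _]; last by rewrite mul0r chi0 mul0r.
have offdiag x y : x != y -> \sum_a \sum_b g x y a b = 0.
  move=> xy.
  under eq_bigr => a _.
    rewrite (reindex_inj (addrI (- (x ^+ 2 + a * x)))) /=.
    under eq_bigr => b _.
      rewrite /g addNKr.
      over.
    over.
  rewrite exchange_big /= big1 // => b _; rewrite -mulr_sumr.
  have yx : y - x != 0 by rewrite subr_eq0 eq_sym.
  have fI : injective (fun a => y ^+ 2 + a * y + (- (x ^+ 2 + a * x) + b)).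
    move=> a a'; have e c : y ^+ 2 + c * y + (- (x ^+ 2 + c * x) + b) =
       c * (y - x) + (y ^+ 2 - x ^+ 2 + b) by ring.
    by rewrite !e => /addIr /(mulIf yx).
  have -> : \sum_a chi (y ^+ 2 + a * y + (- (x ^+ 2 + a * x) + b)) = 0.
    exact: (sum_chi_inj fI).
  by rewrite mulr0.
have diag x : x != 0 -> \sum_y chi (x * y) * \sum_a \sum_b g x y a b
    = #|F|%:Z * #|F|.-1%:Z.
  move=> x0; rewrite (bigD1 x) //= [X in _ + X]big1 ?addr0 => [|y yx]; last first.
    by rewrite (offdiag x y) ?mulr0 // eq_sym.
  rewrite -expr2 chi_sqr1 // mul1r.
  rewrite (eq_bigr (fun=> #|F|.-1%:Z)) => [|a _].
    by rewrite sumr_const -[LHS]mulr_natl natz.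
  rewrite (reindex_inj (addrI (- (x ^+ 2 + a * x)))) /=.
  rewrite (bigD1 0) //= /g addr0 subrr chi0 mul0r add0r.
  rewrite (eq_bigr (fun=> 1)) => [|b b0].
    rewrite sumr_const natz; congr (_%:Z); rewrite -(cardsC1 0).
    by apply: eq_card => b; rewrite !inE.
  by rewrite addNKr -expr2 chi_sqr.
rewrite (eq_bigr _ diag) sumr_const -[LHS]mulr_natl natz expr2 mulrCA; congr (_ * _).
by congr (_%:Z * _); rewrite -(cardsC1 0); apply: eq_card => b; rewrite !inE.
Qed.

(* By [cubic_sum_scale] and [cubic_sum_isogeny], cubic_sum a b ^ 2 is attained on
   the two disjoint scaling orbits of (a, b) and of its 2-isogenous curve, hence
   at least 2 (#|F| - 1) times in the second moment [cubic_sum_moment]. *)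
Lemma cubic_sum_bound a b : a != 0 -> b != 0 -> a ^+ 2 != 8 * b ->
  2 * cubic_sum a b ^+ 2 <= #|F|%:Z * #|F|.-1%:Z.
Proof.
move=> a0 b0 ab.
pose f (z : bool * F) : F * F := if z.1 then (z.2 * a, z.2 ^+ 2 * b)
  else (z.2 * (- 2 * a), z.2 ^+ 2 * (a ^+ 2 - 4 * b)).
pose D := [set z : bool * F | z.2 != 0].
have m2a0 : - 2 * a != 0 by rewrite mulf_neq0 ?oppr_eq0.
(* If the orbits met, the first coordinates would give [d = - 2 d'], and the second then
   [a^2 = 8 b]. *)
have disj d d' : d' != 0 -> f (true, d) <> f (false, d').
  move=> d'0 [h1 h2]; have dd : d = - 2 * d' by apply: (mulIf a0); rewrite h1; ring.
  case/eqP: ab; apply: (mulfI (expf_neq0 2 d'0)).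
  rewrite dd in h2.
  have -> : d' ^+ 2 * (8 * b) = (- 2 * d') ^+ 2 * b + 4 * (d' ^+ 2 * b) by ring.
  by rewrite h2; ring.
have fI : {in D &, injective f}.
  move=> [e d] [e' d']; rewrite !inE /= => d0 d0'.
  case: e; case: e' => //.
  - by move=> [/(mulIf a0) -> _].
  - by move/disj.
  - by move/esym/disj.
  - by move=> [/(mulIf m2a0) -> _].
have trf (z : bool * F) : z \in D -> cubic_sum (f z).1 (f z).2 ^+ 2 = cubic_sum a b ^+ 2.
  case: z => e d; rewrite inE /= => d0.
  case: e; rewrite /f /= cubic_sum_scale // exprMn chi_sqr // mul1r //.
  by rewrite cubic_sum_isogeny.
have : \sum_(z in D) cubic_sum (f z).1 (f z).2 ^+ 2 <= \sum_a \sum_b cubic_sum a b ^+ 2.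
  rewrite pair_bigA /= -(big_imset (fun z : F * F => cubic_sum z.1 z.2 ^+ 2) fI) /=.
  rewrite [leRHS](bigID (mem (f @: D))) /= lerDl.
  by apply: sumr_ge0 => z _; apply: sqr_ge0.
rewrite (eq_bigr _ trf) sumr_const cubic_sum_moment.
have -> : #|D| = (2 * #|F|.-1)%N.
  rewrite -card_bool -(cardsC1 (0 : F)) -cardsT -cardsX.
  by apply: eq_card => -[e d]; rewrite !inE.
have : (1 < #|F|)%N by apply: card_finNzRing_gt1.
case: #|F| => [//|[//|q]] _ /= h.
rewrite -(ler_pM2r (_ : 0 < q.+1%:Z)) //; move: h; rewrite -[leLHS]mulr_natr natz PoszM.
by move=> h; apply: le_trans (le_trans _ h) _; lia.
Qed.

(* A point of this cubic solves x + y + z = 1, 1/x + 1/y + 1/z = N; its points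
   over X = 0, 4, 4 N are degenerate solutions. If there were no others, then
   [cubic_sum] would be 5 - #|F|, against [cubic_sum_bound]. *)
Lemma cubic_square N : chi (- 1 : F) = 1 -> chi (3 : F) = - 1 ->
    (15 < #|F|)%N -> N != 0 -> N != 1 ->
  exists X, [/\ X != 0, X != 4, X != 4 * N &
    is_square (X * (X ^+ 2 + (N ^+ 2 - 6 * N - 3) * X + 16 * N))].
Proof.
move=> chiN1 chi3 F16 N0 N1.
set B := N ^+ 2 - 6 * N - 3; pose P X := X * (X ^+ 2 + B * X + 16 * N).
have four0 : (4 : F) != 0 by rewrite -[4]/(2 * 2)%:R natrM mulf_neq0.
have eight0 : (8 : F) != 0 by rewrite -[8]/(2 * 4)%:R natrM mulf_neq0.
have sixteen0 : (16 : F) != 0 by rewrite -[16]/(2 * 8)%:R natrM mulf_neq0.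
case: (boolP [exists X, [&& X != 0, X != 4, X != 4 * N & is_square (P X)]]).
  by move/existsP => [X /and4P[]]; exists X.
rewrite negb_exists => /forallP noX; exfalso.
have {}noX X : X != 0 -> X != 4 -> X != 4 * N -> chi (P X) = - 1.
  move=> x0 x4 x4N; apply/eqP; rewrite chi_nonsquare.
  by move: (noX X); rewrite x0 x4 x4N.
have N1' : N - 1 != 0 by rewrite subr_eq0.
have P4 : P 4 = (4 * (N - 1)) ^+ 2 by rewrite /P /B; ring.
have P4N : P (4 * N) = (4 * N * (N - 1)) ^+ 2 by rewrite /P /B; ring.
have P4neq0 : P 4 != 0 by rewrite P4 sqrf_eq0 mulf_neq0.
have P4Nneq0 : P (4 * N) != 0 by rewrite P4N sqrf_eq0 !mulf_neq0.
(* The count 5 is 1 for the root [X = 0] plus 2 for each of the distinct abscissas 4 and [4 N]. *)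
have trE : cubic_sum B (16 * N) = 5 - #|F|%:Z.
  have : \sum_X (1 + chi (P X)) = 5.
    rewrite (bigD1 0) //= (bigD1 4) ?four0 //= (bigD1 (4 * N)) /=; last first.
      by rewrite mulf_neq0 //= -subr_eq0 -[X in _ - X]mulr1 -mulrBr mulf_neq0.
    rewrite big1 => [|X /andP[/andP[X0 X4] X4N]]; last by rewrite noX.
    by rewrite /P mul0r chi0 -!/(P _) P4 P4N !chi_sqr1 // -sqrf_eq0 -?P4 -?P4N.
  by rewrite big_split /= sumr_const -/(cubic_sum _ _) => <-; rewrite natz addrAC subrr add0r.
have b0 : 16 * N != 0 by rewrite mulf_neq0.
have noroot X : X ^+ 2 + B * X + 16 * N = 0 -> False.
  move=> h; have PX : P X = 0 by rewrite /P h mulr0.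
  have X0 : X != 0 by apply: contraNneq b0 => X0; rewrite -h X0; apply/eqP; ring.
  have X4 : X != 4 by apply: contraNneq P4neq0 => <-; rewrite PX.
  have X4N : X != 4 * N by apply: contraNneq P4Nneq0 => <-; rewrite PX.
  by have := noX _ X0 X4 X4N; rewrite PX chi0.
(* If [N = m^2], then [P] is a nonsquare at both [4 m] and [- 4 m]. The product of these values is,
   up to squares, the discriminant [B^2 - 64 N], so the quadratic would have a root. *)
have [[m Nm]|nsqN] := is_squareP N.
  have m0 : m != 0 by apply: contraNneq N0 => m0; rewrite Nm m0 expr0n.
  have m1 : m - 1 != 0.
    by apply: contraNneq N1' => /subr0_eq m1; rewrite Nm m1; apply/eqP; ring.
  have m1' : m + 1 != 0.
    have e : N - 1 = (m + 1) * (m - 1) by rewrite Nm; ring.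
    by apply: contraNneq N1' => m1'; rewrite e m1' mul0r.
  have c1 : chi (P (4 * m)) = -1.
    apply: noX; first exact: mulf_neq0.
    - by rewrite -subr_eq0 -[X in _ - X]mulr1 -mulrBr mulf_neq0.
    - rewrite -subr_eq0 Nm (_ : _ - _ = - (4 * m * (m - 1))); last by ring.
      by rewrite oppr_eq0 !mulf_neq0.
  have c2 : chi (P (- 4 * m)) = -1.
    apply: noX; first by rewrite mulf_neq0 ?oppr_eq0.
    - rewrite -subr_eq0 (_ : _ - _ = - (4 * (m + 1))); last by ring.
      by rewrite oppr_eq0 !mulf_neq0.
    - rewrite -subr_eq0 Nm (_ : _ - _ = - (4 * m * (m + 1))); last by ring.
      by rewrite oppr_eq0 !mulf_neq0.
  have e1 : P (4 * m) = (4 * m) ^+ 2 * (B + 8 * m) by rewrite /P /B Nm; ring.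
  have e2 : P (- 4 * m) = (4 * m) ^+ 2 * (B - 8 * m) by rewrite /P /B Nm; ring.
  have [|d dE] := @chi_neqN1 ((B + 8 * m) * (B - 8 * m)).
    by rewrite chiM // -(chiX2M (B + 8 * m) (mulf_neq0 four0 m0)) -e1 c1
      -(chiX2M (B - 8 * m) (mulf_neq0 four0 m0)) -e2 c2.
  apply: (noroot ((- B + d) / 2)).
  have -> : ((- B + d) / 2) ^+ 2 + B * ((- B + d) / 2) + 16 * N
    = (d ^+ 2 - B ^+ 2 + 64 * N) / 4 by field; rewrite ?two_neq0 ?four0.
  by rewrite -dE Nm; field; rewrite ?four0.
have chiN : chi N = -1 by apply/eqP; rewrite chi_nonsquare; apply/is_squareP.
(* [B = (N - 3)^2 - 12], so [B = 0] would make 3 a square. *)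
have B0 : B != 0.
  apply/eqP => B0; apply: (chi_eqN1 (y := (N - 3) / 2) chi3).
  have -> : ((N - 3) / 2) ^+ 2 = (B + 12) / 4 by rewrite /B; field; rewrite ?two_neq0 ?four0.
  by rewrite B0; field; rewrite ?four0.
(* The case where the two orbits coincide: the curve is isogenous to its own twist by the nonsquare
   -2, so its trace vanishes. *)
have [B2|B2] := eqVneq (B ^+ 2) (8 * (16 * N)).
  have chi2 : chi (2 : F) = -1.
    have : chi (8 ^+ 2 * (2 * N)) = 1.
      have -> : 8 ^+ 2 * (2 * N) = B ^+ 2 by rewrite B2; ring.
      exact: chi_sqr1.
    by rewrite chiX2M // chiM // chiN mulrN1 => /eqP; rewrite eqr_oppLR => /eqP.
  have : cubic_sum B (16 * N) = - cubic_sum B (16 * N).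
    rewrite -{1}cubic_sum_isogeny // B2.
    have -> : 8 * (16 * N) - 4 * (16 * N) = (- 2) ^+ 2 * (16 * N) by ring.
    rewrite cubic_sum_scale ?oppr_eq0 // -mulN1r chiM // chiN1 chi2; ring.
  by rewrite trE; clear - F16; lia.
(* With [q = #|F|], the bound [2 (q - 5)^2 <= q (q - 1)] fails for all [q >= 16]. *)
have := cubic_sum_bound B0 b0 B2; rewrite trE; clear - F16.
by move: F16; case: #|F| => [//|q] /= ? ; nia.
Qed.

(** * The quadratic character at -1 and -3 *)

Lemma exists_expf_neq1 k : (0 < k < #|F|.-1)%N -> exists2 x : F, x != 0 & x ^+ k != 1.
Proof.
move=> /andP[k0 kq].
have [/existsP [x /andP[]]|] := boolP [exists x : F, (x != 0) && (x ^+ k != 1)].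
  by exists x.
rewrite negb_exists => /forallP h.
have : (size (enum [set~ 0%R : F]) <= k)%N.
  apply: max_unity_roots (enum_uniq _) => //.
  apply/allP => x; rewrite mem_enum !inE => x0.
  by apply/unity_rootP/eqP; move: (h x); rewrite x0 /= negbK.
by rewrite -cardE cardsC1 leqNgt kq.
Qed.

Lemma expf_card_pred (x : F) : x != 0 -> x ^+ #|F|.-1 = 1.
Proof.
move=> x0; apply: (mulfI x0); rewrite -exprS prednK ?mulr1 ?expf_card //.
by apply/card_gt0P; exists 0.
Qed.

(** If [x^((q-1)/2)] is not 1, it is -1, and [x^((q-1)/4)] is a square root of it. *)
Lemma chiN1_mod4_1 : (#|F| %% 4 = 1)%N -> chi (- 1 : F) = 1.
Proof.
move=> q4; have q1 := card_finNzRing_gt1 F.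
apply: chi_square; first by rewrite oppr_eq0 oner_eq0.
pose k := (#|F| %/ 4)%N; have qk : #|F| = (4 * k).+1 by rewrite /k {1}(divn_eq #|F| 4) q4; lia.
have [|x x0 xk] := @exists_expf_neq1 (2 * k); first by move: q1; rewrite qk; lia.
apply/is_squareP; exists (x ^+ k); rewrite -exprM mulnC.
have /eqP : (x ^+ (2 * k)) ^+ 2 = 1 ^+ 2.
  by rewrite expr1n -(expf_card_pred x0) -exprM qk; congr (_ ^+ _); lia.
by rewrite eqf_sqr (negPf xk) => /eqP.
Qed.

(** As [(q-1)/2] is odd, a square root [y] of -1 would satisfy [y^(q-1) = -1]. *)
Lemma chiN1_mod4_3 : (#|F| %% 4 = 3)%N -> chi (- 1 : F) = - 1.
Proof.
move=> q4; apply/eqP; rewrite chi_nonsquare; apply/is_squareP => -[y yN1].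
have y0 : y != 0.
  by apply/eqP => y0; move/eqP: yN1; rewrite y0 expr0n oppr_eq0 oner_eq0.
pose k := (#|F| %/ 4)%N; have qk : #|F| = (4 * k + 3)%N by rewrite /k {1}(divn_eq #|F| 4) q4; lia.
have := expf_card_pred y0; rewrite (_ : _.-1 = (2 * (2 * k).+1)%N); last by lia.
rewrite exprM -yN1 exprS exprM sqrrN !expr1n mulr1 => /eqP.
by rewrite -subr_eq0 -opprD oppr_eq0 -[1 + 1]/(2) (negPf two_neq0).
Qed.

Hypothesis three_neq0 : (3 : F) != 0.

(** A primitive cube root of unity [w] exists, and [(2 w + 1)^2 = -3]. *)
Lemma chiN3_mod3_1 : (#|F| %% 3 = 1)%N -> chi (- 3 : F) = 1.
Proof.
move=> q3; have q1 := card_finNzRing_gt1 F.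
apply: chi_square; first by rewrite oppr_eq0.
pose k := (#|F| %/ 3)%N; have qk : #|F| = (3 * k).+1 by rewrite /k {1}(divn_eq #|F| 3) q3; lia.
have [|x x0 xk] := @exists_expf_neq1 k; first by move: q1; rewrite qk; lia.
have x3 : (x ^+ k) ^+ 3 = 1.
  by rewrite -(expf_card_pred x0) -exprM qk; congr (_ ^+ _); lia.
move: xk x3; set w := x ^+ k => w1 w3.
have w1' : w - 1 != 0 by rewrite subr_eq0.
have w2 : w ^+ 2 + w + 1 = 0.
  by apply: (mulfI w1'); rewrite mulr0 -[RHS](subrr 1) -[X in _ = X - _]w3; ring.
apply/is_squareP; exists (2 * w + 1).
have -> : (2 * w + 1) ^+ 2 = 4 * (w ^+ 2 + w + 1) - 3 by ring.
by rewrite w2 mulr0 add0r.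
Qed.

(** A square root of -3 yields [w] with [w^2 + w + 1 = 0]; since [q - 1] is 1 mod 3,
    [w = w^(q-1) = 1], whence [3 = 0]. *)
Lemma chiN3_mod3_2 : (#|F| %% 3 = 2)%N -> chi (- 3 : F) = - 1.
Proof.
move=> q3; apply/eqP; rewrite chi_nonsquare; apply/is_squareP => -[r r3].
pose w := (r - 1) / 2.
have w2 : w ^+ 2 + w + 1 = 0.
  have -> : w ^+ 2 + w + 1 = (r ^+ 2 + 3) / 4.
    by rewrite /w; field; rewrite -[4]/(2 * 2)%:R natrM mulf_neq0.
  by rewrite -r3 addNr mul0r.
have w3 : w ^+ 3 = 1.
  have -> : w ^+ 3 = (w - 1) * (w ^+ 2 + w + 1) + 1 by ring.
  by rewrite w2 mulr0 add0r.
have w0 : w != 0 by apply/eqP => w0; move/eqP: w3; rewrite w0 expr0n eq_sym oner_eq0.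
pose k := (#|F| %/ 3)%N; have qk : #|F| = (3 * k + 2)%N by rewrite /k {1}(divn_eq #|F| 3) q3; lia.
have := expf_card_pred w0; rewrite (_ : _.-1 = (3 * k).+1); last by lia.
rewrite exprS exprM w3 expr1n mulr1 => w1.
move/eqP: w2; rewrite w1 (_ : _ + 1 = 3); last by ring.
by rewrite (negPf three_neq0).
Qed.

Lemma sum_chi_conicN c : c != 0 -> \sum_(x : F) chi (c - x ^+ 2) = - chi (- 1 : F).
Proof.
move=> c0; under eq_bigr => x _ do rewrite -opprB -mulN1r chiM //.
by rewrite -mulr_sumr sum_chi_conic // mulrN1.
Qed.

Lemma card_circle : #|[set z : F * F | z.1 ^+ 2 + z.2 ^+ 2 == 1]|%:Z = #|F|%:Z - chi (- 1 : F).
Proof.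
rewrite -(sum_card_fiber fst) -(sum_chi_conicN (oner_neq0 F)).
rewrite -[X in _ = X + _]natz -sumr_const -big_split /=; apply: eq_bigr => x _.
have pI : injective (pair x : F -> F * F) by move=> y z [].
rewrite -card_sqrt // -[in RHS](card_imset _ pI).
congr (_%:Z); apply: eq_card => -[z y]; rewrite !inE /=; apply/andP/imsetP.
  move=> [/eqP h /eqP zx]; rewrite zx in h *; exists y => //.
  by rewrite inE -h addrC addKr.
by move=> [t]; rewrite inE => /eqP h [-> ->]; split=> //; rewrite h addrC subrK.
Qed.

(* Both 1 + chi (N - c ^ 2) and 1 + chi (M * (4 - M)), with M = N + 1 - 2 c,
   have average 1 + 1 / #|F| over c. *)
Lemma conic_pair N : chi (- 1 : F) = - 1 -> N != 0 ->
  exists c, [/\ N + 1 - 2 * c != 0, is_square (N - c ^+ 2) &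
    is_square ((N + 1 - 2 * c) * (4 - (N + 1 - 2 * c)))].
Proof.
move=> chiN1 N0; pose M c := N + 1 - 2 * c.
have [/existsP [c /and3P []]|] :=
    boolP [exists c, [&& M c != 0, is_square (N - c ^+ 2) & is_square (M c * (4 - M c))]].
  by exists c.
rewrite negb_exists => /forallP noc; exfalso.
have s1 : \sum_c chi (N - c ^+ 2) = 1 by rewrite sum_chi_conicN // chiN1 opprK.
have four0 : (4 : F) != 0 by rewrite -[4]/(2 * 2)%:R natrM mulf_neq0.
have s2 : \sum_c chi (M c * (4 - M c)) = 1.
  (* [M (4 - M) = 4 - (M - 2)^2], and [M c - 2] runs over [F] with [c]. *)
  have fI : injective (fun c => M c - 2).
    by move=> c d /addIr /addrI /oppr_inj /(mulfI two_neq0).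
  rewrite -[RHS]opprK -chiN1 -(sum_chi_conicN four0) [RHS](reindex_inj fI) /=.
  by apply: eq_bigr => c _; congr chi; ring.
have c0 : M ((N + 1) / 2) = 0 by rewrite /M; field.
(* The term at the excluded [c], where [M c = 0], is at most 1; any other term contains a -1 and is
   at most 0. But the two sums add up to 2. *)
have : \sum_c (chi (N - c ^+ 2) + chi (M c * (4 - M c))) <= 1.
  rewrite (bigD1 ((N + 1) / 2)) //= c0 mul0r chi0 addr0.
  rewrite -[leRHS]addr0 lerD //; first exact: chi_le1.
  apply: sumr_le0 => c cN.
  have Mc : M c != 0.
    apply: contra_neq cN => Mc; have -> : N + 1 = M c + 2 * c by rewrite /M; ring.
    by rewrite Mc; field.
  move: (noc c); rewrite Mc /= negb_and -!chi_nonsquare.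
  by case/orP => /eqP ->; rewrite ?[- 1 + _]addrC subr_le0; exact: chi_le1.
by rewrite big_split /= s1 s2.
Qed.

End QuadraticCharacter.

(** * Lee codes from a symmetric set of syndromes *)

(** Serves on both sides of the syndrome map: for words, with [U] the unit words, and for syndromes,
    with [U] the conic. *)
Definition short_sum (V : zmodType) (U : {pred V}) (k : nat) (v : V) : Prop :=
  exists s : seq V, [/\ {subset s <= U}, (size s <= k)%N & v = \sum_(x <- s) x].

Lemma short_sum_cons (V : zmodType) (U : {pred V}) k (u v : V) :
  u \in U -> short_sum U k v -> short_sum U k.+1 (u + v).
Proof.
move=> uU [s [sU ks ->]]; exists (u :: s); split=> //; last by rewrite big_cons.
by move=> x; rewrite inE => /predU1P[->|/sU].
Qed.

Lemma short_sum0 (V : zmodType) (U : {pred V}) k : short_sum U k 0.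
Proof. by exists [::]; rewrite big_nil. Qed.

Lemma short_sum1 (V : zmodType) (U : {pred V}) k (x : V) :
  x \in U -> short_sum U k.+1 x.
Proof. by move=> xU; rewrite -[x]addr0; apply: short_sum_cons xU (short_sum0 _ _). Qed.

Lemma short_sum3 (V : zmodType) (U : {pred V}) (x y z : V) :
  x \in U -> y \in U -> z \in U -> short_sum U 3 (x + y + z).
Proof.
by move=> xU yU zU; rewrite -addrA; do 2!apply: short_sum_cons => //; apply: short_sum1.
Qed.

Lemma short_sumP2 (V : zmodType) (U : {pred V}) (v : V) : short_sum U 2 v ->
  [\/ v = 0, v \in U | exists x y, [/\ x \in U, y \in U & v = x + y]].
Proof.
case=> s []; case: s => [|x [|y [|z s]]] // sU _ ->; rewrite ?big_cons ?big_nil ?addr0.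
- exact: Or31.
- by apply: Or32; apply: sU; rewrite inE.
- by apply: Or33; exists x, y; split=> //; apply: sU; rewrite !inE eqxx ?orbT.
Qed.

(** From each pair [x], [- x] the element of smaller rank in the enumeration of [V] is kept; the
    kept ones become the rows of the matrix [H] below. *)
Lemma half_system (V : finZmodType) (n : nat) (U : {set V}) :
    #|U| = n.*2 -> {in U, forall x, - x \in U} -> {in U, forall x, x != - x} ->
  exists h : 'I_n -> V, [/\ forall i, h i \in U, injective h,
    forall i j, h i != - h j & {in U, forall x, exists i, x = h i \/ x = - h i}].
Proof.
move=> cardU UN nfix; pose r (x : V) : nat := enum_rank x.
pose A := [set x in U | (r x < r (- x)%R)%N].
have rI : injective r by move=> x y /val_inj /enum_rank_inj.
have UE : U = A :|: -%R @: A.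
  apply/setP=> x; rewrite !inE; apply/idP/idP => [xU|].
    rewrite xU /=; have := nfix x xU; rewrite -(inj_eq rI) neq_ltn.
    case/orP => [->//|lt]; apply/orP; right; apply/imsetP; exists (- x); rewrite ?opprK //.
    by rewrite inE UN //= opprK.
  by case/orP => [/andP[]//|/imsetP[y + ->]]; rewrite inE => /andP[/UN].
have dis : [disjoint A & -%R @: A].
  rewrite disjoint_subset; apply/subsetP => x; rewrite !inE => /andP[_ lt].
  apply/negP => /imsetP[y + xy]; rewrite inE => /andP[_ lt'].
  by move: lt; rewrite xy opprK ltnNge ltnW.
have cardA : #|A| = n.
  apply: double_inj; rewrite -cardU UE cardsU (disjoint_setI0 dis) cards0 subn0.
  by rewrite card_imset ?addnn //; apply: oppr_inj.
exists (fun i => enum_val (cast_ord (esym cardA) i)); split.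
- by move=> i; have := enum_valP (cast_ord (esym cardA) i); rewrite inE => /andP[].
- by move=> i j /enum_val_inj /cast_ord_inj.
- move=> i j; apply/eqP => h; have := disjointFr dis (enum_valP (cast_ord (esym cardA) i)).
  by rewrite h imset_f // enum_valP.
- move=> x; rewrite {1}UE inE => /orP[xA|/imsetP[y yA ->]].
    by exists (cast_ord cardA (enum_rank_in xA x)); left; rewrite cast_ordK enum_rankK_in.
  by exists (cast_ord cardA (enum_rank_in yA y)); right; rewrite cast_ordK enum_rankK_in.
Qed.

(** * Lee weight as word length *)

Section LeeCode.
Variable p : nat.
Local Notation F := 'F_p.

Lemma lee_weight_intr (s : int) : (lee_weight (s%:~R : F) <= `|s|)%N.
Proof.
by rewrite /lee_weight; case: ex_minnP => k _; apply; apply/has_repP; exists s.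
Qed.

Lemma lee_weight_rep (x : F) : exists2 s : int, s%:~R = x & `|s|%N = lee_weight x.
Proof. by rewrite /lee_weight; case: ex_minnP => k /has_repP [s <- <-] _; exists s. Qed.

Lemma lee_weightD (x y : F) : (lee_weight (x + y)%R <= lee_weight x + lee_weight y)%N.
Proof.
have [s <- <-] := lee_weight_rep x; have [t <- <-] := lee_weight_rep y.
by rewrite -rmorphD; apply: leq_trans (lee_weight_intr _) _; lia.
Qed.

Lemma lee_weight_eq0 (x : F) : (lee_weight x == 0)%N = (x == 0).
Proof.
apply/eqP/eqP => [x0|->]; last by apply/eqP; rewrite -leqn0 (lee_weight_intr 0).
by have [s sx] := lee_weight_rep x; rewrite x0 -sx => /eqP; rewrite absz_eq0 => /eqP ->.
Qed.

Lemma lee_weight_step (x : F) : x != 0 ->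
  exists2 e : F, (e == 1) || (e == - 1) & (lee_weight (x - e)%R < lee_weight x)%N.
Proof.
have [s <- <-] := lee_weight_rep x => s0.
have {}s0 : s != 0 by apply: contraNneq s0 => ->.
have [s_gt0|s_lt0] := ltP 0 s.
  exists 1; rewrite ?eqxx //; rewrite -(rmorphB _ s 1).
  by apply: leq_ltn_trans (lee_weight_intr _) _; lia.
exists (- 1); rewrite ?eqxx ?orbT //; rewrite -(rmorphB _ s (- 1)).
by apply: leq_ltn_trans (lee_weight_intr _) _; lia.
Qed.

Variable n : nat.

Definition lee_wt (w : 'rV[F]_n) : nat := (\sum_j lee_weight (w 0%R j))%N.

Lemma lee_distE (v w : 'rV[F]_n) : lee_dist v w = lee_wt (v - w)%R.
Proof. by apply: eq_bigr => j _; rewrite !mxE. Qed.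

Definition unit_words : {set 'rV[F]_n} :=
  [set w | [exists i, (w == delta_mx 0 i) || (w == - delta_mx 0 i)]].

Lemma unit_wordsP w : reflect (exists i, w = delta_mx 0 i \/ w = - delta_mx 0 i)
  (w \in unit_words).
Proof.
rewrite inE; apply: (iffP existsP) => [[i /orP[]/eqP]|[i []->]]; exists i; auto.
  by rewrite eqxx.
by rewrite eqxx orbT.
Qed.

Lemma unit_wordsN w : w \in unit_words -> - w \in unit_words.
Proof.
by move=> /unit_wordsP[i []->]; apply/unit_wordsP; exists i; rewrite ?opprK; auto.
Qed.

Lemma unit_word_coord w i : w \in unit_words ->
  exists2 e : int, (-1 <= e) && (e <= 1) & w 0 i = e%:~R.
Proof.
move=> /unit_wordsP[j []->]; rewrite !mxE eqxx /=; case: eqP => _.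
- by exists 1.
- by exists 0.
- by exists (- 1).
- by exists 0; rewrite ?oppr0.
Qed.

Lemma unit_word_coord0 w i : w \in unit_words -> w != delta_mx 0 i -> w != - delta_mx 0 i ->
  w 0 i = 0.
Proof.
by move=> /unit_wordsP[j []->]; rewrite !mxE eqxx /=; case: (eqVneq i j) => [->|] //;
  rewrite ?eqxx ?oppr0.
Qed.

Lemma lee_wtD (v w : 'rV[F]_n) : (lee_wt (v + w)%R <= lee_wt v + lee_wt w)%N.
Proof. by rewrite -big_split leq_sum // => j _; rewrite mxE lee_weightD. Qed.

Lemma lee_wt0 : lee_wt 0 = 0%N.
Proof. by apply: big1 => j _; apply/eqP; rewrite lee_weight_eq0 mxE. Qed.

Lemma lee_wt_unit w : w \in unit_words -> (lee_wt w <= 1)%N.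
Proof.
case/unit_wordsP => i wE; rewrite /lee_wt (bigD1 i) //= big1 => [|j ji].
  rewrite addn0; case: wE => ->; rewrite !mxE !eqxx; first exact: (lee_weight_intr 1).
  exact: (lee_weight_intr (-1)).
by apply/eqP; rewrite lee_weight_eq0; case: wE => ->; rewrite !mxE (negPf ji) ?oppr0.
Qed.

(** The triangle inequality gives one direction; for the other, a unit step towards 0 in a nonzero
    coordinate lowers the weight. *)
Lemma lee_wt_le (w : 'rV[F]_n) (k : nat) : (lee_wt w <= k)%N <->
  short_sum (mem unit_words) k w.
Proof.
split=> [|[s [sE ks ->]]]; last first.
  apply: leq_trans ks; elim: s sE => [|x s IH] sE; first by rewrite big_nil lee_wt0.
  rewrite big_cons; apply: leq_trans (lee_wtD _ _) _ => /=.
  rewrite -[(size s).+1]add1n leq_add //.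
    by apply: lee_wt_unit; apply: sE; rewrite inE eqxx.
  by apply: IH => y ys; apply: sE; rewrite inE ys orbT.
elim: k w => [|k IH] w wk.
  rewrite (_ : w = 0); first exact: short_sum0.
  apply/rowP => i; apply/eqP; rewrite mxE -lee_weight_eq0 -leqn0.
  by apply: leq_trans wk; rewrite /lee_wt (bigD1 i) //= leq_addr.
have [->|] := eqVneq w 0; first exact: short_sum0.
case/rV0Pn => i wi; have [e e1 lt] := lee_weight_step wi.
rewrite -[w](subrKC (e *: delta_mx 0 i)).
apply: short_sum_cons.
  apply/unit_wordsP; exists i.
  by case/orP: e1 => /eqP ->; rewrite ?scaleN1r ?scale1r; auto.
apply: IH; rewrite -ltnS; apply: leq_trans wk.
rewrite /lee_wt (bigD1 i) //= [X in (_ < X)%N](bigD1 i) //= -addSn leq_add //.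
  by rewrite !mxE !eqxx mulr1.
by apply: leq_sum => j ji; rewrite !mxE (negPf ji) /= mulr0 subr0.
Qed.

End LeeCode.

Lemma intr_Fp_eq0 (p : nat) (m : int) : prime p -> (m%:~R == 0 :> 'F_p) = (p %| `|m|)%N.
Proof.
move=> pp; rewrite (dvdn_pcharf (pchar_Fp pp)); case: m => m /=; first by rewrite -pmulrn.
by rewrite NegzE mulrNz oppr_eq0 -pmulrn.
Qed.

(** [U] is the set of syndromes of the unit words. [U21] and [U22] separate the syndromes of words
    of weight at most 2; [cov3] and [ncov2] fix the covering radius at 3; the relation
    [u *+ 3 = x + y + z] rules out correcting three errors. *)
Lemma quasi_perfect_code (p k n : nat) (U : {set 'rV['F_p]_k}) :
    prime p -> (5 < p)%N -> #|U| = n.*2 ->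
    {in U, forall x, - x \in U} ->
    {in U & &, forall x y z, x + y <> z} ->
    (forall x y z t, x \in U -> y \in U -> z \in U -> t \in U ->
       x + y = z + t -> [\/ x + y = 0, x = z | x = t]) ->
    (forall v, short_sum (mem U) 3 v) ->
    (exists v, ~ short_sum (mem U) 2 v) ->
    (exists u x y z, [/\ u \in U, x \in U, y \in U & z \in U] /\
       [/\ u *+ 3 = x + y + z, x != u & x != - u]) ->
  exists C : {set 'rV['F_p]_n},
    [/\ linear_code C, quasi_perfect C 2 & #|C| = (p ^ (n - k))%N].
Proof.
move=> pp p5 cardU UN U21 U22 cov3 [v0 ncov2] [u [x [y [z [[uU xU yU zU] [uxyz xu xNu]]]]]].
have U0 a : a \in U -> a != 0.
  by move=> aU; apply/eqP => a0; apply: (U21 a a a) => //; rewrite a0 addr0.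
have [|h [hU hI hN hsurj]] := half_system cardU UN.
  move=> a aU; rewrite -addr_eq0 -mulr2n -scaler_nat scaler_eq0 (negPf (U0 a aU)) orbF.
  by rewrite (intr_Fp_eq0 2) //; apply/negP => /dvdn_leq; clear - p5; lia.
pose H : 'M['F_p]_(n, k) := \matrix_i h i.
pose E := unit_words p n.
have Hdelta i : delta_mx 0 i *m H = h i by rewrite -rowE rowK.
have EU e : e \in E -> e *m H \in U.
  by move=> /unit_wordsP[i []->]; rewrite ?mulNmx Hdelta // UN.
have EI e f : e \in E -> f \in E -> e *m H = f *m H -> e = f.
  move=> /unit_wordsP[i []->] /unit_wordsP[j []->]; rewrite ?mulNmx !Hdelta.
  - by move/hI ->.
  - by move/eqP; rewrite (negPf (hN _ _)).
  - by move/esym/eqP; rewrite (negPf (hN _ _)).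
  - by move/oppr_inj/hI ->.
have UE a : a \in U -> exists2 e, e \in E & e *m H = a.
  move=> /hsurj [i [->|->]]; [exists (delta_mx 0 i)|exists (- delta_mx 0 i)];
    rewrite ?mulNmx ?Hdelta //; apply/unit_wordsP; exists i; auto.
have sumUE r v : short_sum (mem U) r v -> exists2 w, short_sum (mem E) r w & w *m H = v.
  move=> [s [sU rs ->]]; elim: s r rs sU => [|a s IH] r.
    by move=> _ _; exists 0; rewrite ?mul0mx ?big_nil //; apply: short_sum0.
  case: r => [//|r] rs sU; have [e eE <-] := UE a (sU a (mem_head _ _)).
  have [|w wE wv] := IH r rs; first by move=> b bs; apply: sU; rewrite inE bs orbT.
  by exists (e + w); [apply: short_sum_cons|rewrite mulmxDl wv big_cons].
have sumEU r w : short_sum (mem E) r w -> short_sum (mem U) r (w *m H).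
  move=> [s [sE rs ->]]; exists [seq e *m H | e <- s]; split; rewrite ?size_map //.
    by move=> _ /mapP[e /sE eE ->]; apply: EU.
  by rewrite mulmx_suml big_map.
have inj2 a b : short_sum (mem E) 2 a -> short_sum (mem E) 2 b -> a *m H = b *m H -> a = b.
  have E0 e : e \in E -> e *m H <> 0 by move=> /EU /U0 /eqP.
  have E2 e f g : e \in E -> f \in E -> g \in E -> (e + f) *m H <> g *m H.
    by move=> eE fE gE; rewrite mulmxDl; apply: U21; apply: EU.
  have E20 e f : e \in E -> f \in E -> (e + f) *m H = 0 -> e + f = 0.
    move=> eE fE; rewrite mulmxDl => /eqP; rewrite addr_eq0 -mulNmx => /eqP /EI -> //.
      by rewrite addNr.
    exact: unit_wordsN.
  move=> /short_sumP2[->|aE|[a1 [a2 [a1E a2E ->]]]]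
         /short_sumP2[->|bE|[b1 [b2 [b1E b2E ->]]]]; rewrite ?mul0mx //.
  - by move/esym/E0 => /(_ bE).
  - by move/esym/E20 => ->.
  - by move/E0 => /(_ aE).
  - exact: EI.
  - by move/esym/E2; case.
  - exact: E20.
  - by move/E2; case.
  move=> ab; move: (ab); rewrite !mulmxDl.
  case/U22; rewrite ?EU //.
  - rewrite -mulmxDl => a0; rewrite (E20 _ _ a1E a2E a0).
    by rewrite a0 in ab; rewrite (E20 _ _ b1E b2E (esym ab)).
  - move=> e1; rewrite (EI _ _ a1E b1E e1); congr (_ + _); apply: EI => //.
    by move: ab; rewrite !mulmxDl e1 => /addrI.
  - move=> e1; rewrite (EI _ _ a1E b2E e1) addrC; congr (_ + _); apply: EI => //.
    by move: ab; rewrite !mulmxDl e1 [RHS]addrC => /addrI.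
pose C : {set 'rV['F_p]_n} := [set w | w *m H == 0].
exists C; split.
- by split=> [|a b]; rewrite !inE ?mul0mx // => /eqP ha /eqP hb; rewrite mulmxBl ha hb subr0.
- split; split.
  + move=> w c c'; rewrite !inE !lee_distE => /eqP cC /eqP cC' /lee_wt_le wc /lee_wt_le wc'.
    suff /addrI /oppr_inj : w - c = w - c' by [].
    by apply: inj2; rewrite // !mulmxBl cC cC'.
  + move=> t tC; rewrite leqNgt; apply/negP => t3.
    have [eu euE euH] := UE u uU; have [ex exE exH] := UE x xU.
    have [ey eyE eyH] := UE y yU; have [ez ezE ezH] := UE z zU.
    have wt3 a b c : a \in E -> b \in E -> c \in E -> (lee_wt (a + b + c)%R <= t)%N.
      move=> aE bE cE; apply: leq_trans t3; apply/lee_wt_le; exists [:: a; b; c].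
      split=> //; last by rewrite !big_cons big_nil addr0 addrA.
      by move=> d; rewrite 2!in_cons mem_seq1 => /or3P[]/eqP->.
    (* Equal syndromes make [a - b] a codeword, and both [0] and [a - b] lie within distance 3 of
       [a]. *)
    pose a := eu + eu + eu; pose b := ex + ey + ez.
    have aH : a *m H = u *+ 3 by rewrite !mulmxDl euH mulrS mulr2n addrA.
    have bH : b *m H = u *+ 3 by rewrite !mulmxDl exH eyH ezH.
    have ab : a = b.
      have : 0 = a - b.
        apply: (tC a); rewrite ?inE ?mul0mx ?mulmxBl ?aH ?bH ?subrr //.
          by rewrite lee_distE subr0 wt3.
        by rewrite lee_distE opprB addrC subrK wt3.
      by move/esym/eqP; rewrite subr_eq0 => /eqP.
    have [i euE'] := unit_wordsP _ euE.
    have [d d1 eui] : exists2 d : int, `|d|%N = 1%N & eu 0 i = d%:~R.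
      by case: euE' => ->; [exists 1|exists (- 1)]; rewrite // !mxE !eqxx.
    have exi : ex 0 i = 0.
      have exu : ex != eu by apply: contraNneq xu => e; rewrite -exH e euH.
      have exNu : ex != - eu by apply: contraNneq xNu => e; rewrite -exH e mulNmx euH.
      by case: euE' exu exNu => ->; rewrite ?opprK => *; apply: unit_word_coord0.
    have [e2 e2b eyi] := unit_word_coord i eyE; have [e3 e3b ezi] := unit_word_coord i ezE.
    have := congr1 (fun w : 'rV_n => w 0 i) ab.
    rewrite /a /b !mxE exi eyi ezi eui add0r => e.
    (* At the coordinate of [eu], where [ex] vanishes, the integer [3 d - e2 - e3] has absolute
       value between 1 and 5, so [p > 5] cannot divide it. *)
    have /eqP : (d + d + d - (e2 + e3))%:~R = 0 :> 'F_p.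
      by rewrite intrB !intrD e subrr.
    by rewrite intr_Fp_eq0 // => /dvdn_leq; clear - p5 d1 e2b e3b; lia.
  + move=> w; have [a aE aH] := sumUE _ _ (cov3 (w *m H)); exists (w - a).
      by rewrite inE mulmxBl aH subrr.
    by rewrite lee_distE opprB addrC subrK; apply/lee_wt_le.
  + move=> r rC; rewrite ltnNge; apply/negP => r2; apply: ncov2.
    have [a _ <-] := sumUE _ _ (cov3 v0); have [c] := rC a.
    rewrite inE lee_distE => /eqP cH ac.
    rewrite -[a *m H]subr0 -cH -mulmxBl; apply: sumEU; apply/lee_wt_le.
    exact: leq_trans ac r2.
(* Every basis vector is a syndrome, so [H] has rank [k]. *)
- have fullH : row_full H.
    rewrite -sub1mx; apply/row_subP => i; apply/submxP.
    by have [w _ wH] := sumUE _ _ (cov3 (row i 1%:M)); exists w.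
  rewrite (_ : C = rowg (kermx H)); last first.
    by apply/setP => w; rewrite !inE sub_kermx.
  by rewrite card_rowg mxrank_ker (eqP fullH) card_Fp.
Qed.

(** * Row vectors of length two *)

Definition vec2 (R : Type) (a b : R) : 'rV[R]_2 := \row_j (if j == 0 then a else b).

Lemma vec2_0 (R : Type) (a b : R) : vec2 a b 0 0 = a.
Proof. by rewrite mxE. Qed.

Lemma vec2_1 (R : Type) (a b : R) : vec2 a b 0 1 = b.
Proof. by rewrite mxE. Qed.

Definition vec2E := (vec2_0, vec2_1).

Lemma rV2P (R : Type) (v w : 'rV[R]_2) : v 0 0 = w 0 0 -> v 0 1 = w 0 1 -> v = w.
Proof.
move=> h0 h1; apply/rowP => -[[|[|//]] lt].
  by rewrite (_ : Ordinal lt = 0) //; apply: val_inj.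
by rewrite (_ : Ordinal lt = 1) //; apply: val_inj.
Qed.

Lemma card_rV2 (F : finType) (P : F -> F -> bool) :
  #|[set v : 'rV[F]_2 | P (v 0 0) (v 0 1)]| = #|[set z : F * F | P z.1 z.2]|.
Proof.
pose f (z : F * F) := vec2 z.1 z.2.
have fI : injective f.
  by move=> [a b] [c d] h; rewrite -[a](vec2_0 a b) -{2}[b](vec2_1 a b) -/(f (a, b)) h /f !vec2E.
rewrite -(card_imset _ fI); apply: eq_card => v; rewrite inE; apply/idP/imsetP.
  by move=> Pv; exists (v 0 0, v 0 1); [rewrite inE|apply: rV2P; rewrite vec2E].
by move=> [[a b]]; rewrite inE /= => Pab ->; rewrite !vec2E.
Qed.

(** * The hyperbola, for p = 5 mod 12 *)

Section Hyperbola.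
Variable F : finFieldType.
Hypothesis natF : forall k : nat, (0 < k < 17)%N -> (k%:R : F) != 0.
Hypothesis chiN1 : chi (- 1 : F) = 1.
Hypothesis chi3 : chi (3 : F) = - 1.
Hypothesis cardF : (15 < #|F|)%N.

Definition hyperbola : {set 'rV[F]_2} := [set v : 'rV[F]_2 | v 0 0 * v 0 1 == 1].

Let two_neq0 : (2 : F) != 0. Proof. exact: natF. Qed.

Lemma hyperbolaP (v : 'rV[F]_2) : reflect (v 0 0 * v 0 1 = 1) (v \in hyperbola).
Proof. by rewrite inE; apply: eqP. Qed.

Lemma hyperbola_vec2 a : a != 0 -> vec2 a a^-1 \in hyperbola.
Proof. by move=> a0; rewrite inE !vec2E mulfV. Qed.

Lemma hyperbola_inj (v w : 'rV[F]_2) : v \in hyperbola -> w \in hyperbola ->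
  v 0 0 = w 0 0 -> v = w.
Proof.
move=> /hyperbolaP hv /hyperbolaP hw e; apply: rV2P => //.
have v0 : v 0 0 != 0 by apply/eqP => v0; move/eqP: hv; rewrite v0 mul0r eq_sym oner_eq0.
by apply: (mulfI v0); rewrite hv e hw.
Qed.

Lemma hyperbolaN : {in hyperbola, forall v, - v \in hyperbola}.
Proof. by move=> v; rewrite !inE !mxE mulrNN. Qed.

Lemma card_hyperbolaE : #|hyperbola| = #|F|.-1.
Proof.
rewrite /hyperbola (card_rV2 (fun a b : F => a * b == 1)).
by rewrite card_hyperbola ?oner_eq0.
Qed.

(** If [x + y] were on the hyperbola, the cross products [t], [t'] would have product 1 and sum -1,
    making -3 a square. *)
Lemma hyperbola_sum2 : {in hyperbola & &, forall x y z, x + y <> z}.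
Proof.
move=> x y z /hyperbolaP hx /hyperbolaP hy /hyperbolaP hz xyz.
move: hz; rewrite -xyz !mxE; set t := x 0 0 * y 0 1; set t' := y 0 0 * x 0 1 => hz.
have tt : t * t' = 1.
  have -> : t * t' = (x 0 0 * x 0 1) * (y 0 0 * y 0 1) by rewrite /t /t'; ring.
  by rewrite hx hy mulr1.
have st : t + t' = - 1.
  have -> : t + t' = (x 0 0 + y 0 0) * (x 0 1 + y 0 1) - x 0 0 * x 0 1 - y 0 0 * y 0 1.
    by rewrite /t /t'; ring.
  by rewrite hz hx hy; ring.
apply: (@chi_eqN1 F (- 3) (t - t')).
  by rewrite -mulN1r chiM // chiN1 chi3.
have -> : (t - t') ^+ 2 = (t + t') ^+ 2 - 4 * (t * t') by ring.
by rewrite tt st; ring.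
Qed.

(** A nonzero sum determines the product of the first coordinates as well as their sum, hence the
    pair of first coordinates. *)
Lemma hyperbola_sum22 x y z t : x \in hyperbola -> y \in hyperbola ->
  z \in hyperbola -> t \in hyperbola -> x + y = z + t -> [\/ x + y = 0, x = z | x = t].
Proof.
move=> xH yH zH tH e.
have /hyperbolaP hx := xH; have /hyperbolaP hy := yH.
have /hyperbolaP hz := zH; have /hyperbolaP ht := tH.
have e0 : x 0 0 + y 0 0 = z 0 0 + t 0 0 by have := congr1 (fun v : 'rV_2 => v 0 0) e; rewrite !mxE.
have e1 : x 0 1 + y 0 1 = z 0 1 + t 0 1 by have := congr1 (fun v : 'rV_2 => v 0 1) e; rewrite !mxE.
have prod (v w : 'rV[F]_2) : v 0 0 * v 0 1 = 1 -> w 0 0 * w 0 1 = 1 ->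
    v 0 0 * w 0 0 * (v 0 1 + w 0 1) = v 0 0 + w 0 0.
  move=> hv hw; have -> : v 0 0 * w 0 0 * (v 0 1 + w 0 1)
    = (v 0 0 * v 0 1) * w 0 0 + (w 0 0 * w 0 1) * v 0 0 by ring.
  by rewrite hv hw !mul1r addrC.
have [r0|r0] := eqVneq (x 0 1 + y 0 1) 0.
  apply: Or31; apply: rV2P; rewrite !mxE //.
  by rewrite -prod // r0 mulr0.
have P : x 0 0 * y 0 0 = z 0 0 * t 0 0.
  by apply: (mulIf r0); rewrite prod // e1 prod.
have : (x 0 0 - z 0 0) * (x 0 0 - t 0 0) = 0.
  have -> : (x 0 0 - z 0 0) * (x 0 0 - t 0 0)
    = x 0 0 ^+ 2 - (z 0 0 + t 0 0) * x 0 0 + z 0 0 * t 0 0 by ring.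
  by rewrite -e0 -P; ring.
move/eqP; rewrite mulf_eq0 !subr_eq0 => /orP[]/eqP h.
  by apply: Or32; apply: hyperbola_inj.
by apply: Or33; apply: hyperbola_inj.
Qed.

Lemma hyperbola_cover_isotropic a : a != 0 ->
  short_sum (mem hyperbola) 3 (vec2 a 0) /\ short_sum (mem hyperbola) 3 (vec2 0 a).
Proof.
move=> a0; have three0 : (3 : F) != 0 by exact: natF.
(* The proportions 2 : 2 : -1 have sum 3, and their reciprocals add up to 0. *)
pose b := 2 * a / 3; pose c := - a / 3.
have b0 : b != 0 by rewrite !mulf_neq0 ?invr_eq0.
have c0 : c != 0 by rewrite mulf_neq0 ?oppr_eq0 ?invr_eq0.
have bH := hyperbola_vec2 b0; have cH := hyperbola_vec2 c0.
have swap (v : 'rV[F]_2) : v \in hyperbola -> vec2 (v 0 1) (v 0 0) \in hyperbola.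
  by rewrite !inE !vec2E mulrC.
have e1 : b + b + c = a by rewrite /b /c; field.
have e2 : b^-1 + b^-1 + c^-1 = 0 by rewrite /b /c; field; rewrite ?oppr_eq0 ?a0 ?two_neq0 ?three0.
split.
  have -> : vec2 a 0 = vec2 b b^-1 + vec2 b b^-1 + vec2 c c^-1.
    by apply: rV2P; rewrite !mxE /= ?e1 ?e2.
  exact: short_sum3.
have -> : vec2 0 a = vec2 b^-1 b + vec2 b^-1 b + vec2 c^-1 c.
  by apply: rV2P; rewrite !mxE /= ?e1 ?e2.
by apply: short_sum3; rewrite inE !vec2E mulVf.
Qed.

(** Off the axes, dividing first coordinates by [a] reduces the claim to [x + y + z = 1],
    [1/x + 1/y + 1/z = N] with [N = a b], which a point of the cubic solves. *)
Lemma hyperbola_cover v : short_sum (mem hyperbola) 3 v.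
Proof.
pose a := v 0 0; pose b := v 0 1.
have vE : v = vec2 a b by apply: rV2P; rewrite !vec2E.
have [a0|a0] := eqVneq a 0.
  have [b0|b0] := eqVneq b 0; last by rewrite vE a0; case: (hyperbola_cover_isotropic b0).
  rewrite (_ : v = 0); first exact: short_sum0.
  by rewrite vE a0 b0; apply: rV2P; rewrite !mxE.
have [b0|b0] := eqVneq b 0; first by rewrite vE b0; case: (hyperbola_cover_isotropic a0).
have [ab1|ab1] := eqVneq (a * b) 1.
  by apply: short_sum1; apply/hyperbolaP.
have N0 : a * b != 0 by rewrite mulf_neq0.
have [X [X0 X4 X4N /is_squareP [r]]] := cubic_square two_neq0 chiN1 chi3 cardF N0 ab1.
set N := a * b in N0 ab1 X4N * => rE.
have four0 : (4 : F) != 0 by exact: natF.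
have d0 : 4 - X != 0 by rewrite subr_eq0 eq_sym.
have d1 : 4 * N - X != 0 by rewrite subr_eq0 eq_sym.
(* Here [X = 4 N (1 - x) / (1 - N x)], and [y], [z] are the roots of the quadratic with sum [1 - x]
   and product [(1 - x) / (N - 1/x)], whose discriminant is [r^2] up to a square. Excluding 0, 4 and
   [4 N] keeps all three defined and nonzero. *)
pose x := (4 * N - X) / (N * (4 - X)).
pose y := (- X * (N - 1) + r) / (2 * N * (4 - X)).
pose z := (- X * (N - 1) - r) / (2 * N * (4 - X)).
have yzS : y + z = - X * (N - 1) / (N * (4 - X)).
  by rewrite /y /z; field; rewrite ?d0 ?N0 ?two_neq0.
have yzP : y * z = - X * (4 * N - X) / (4 * N ^+ 2 * (4 - X)).
  have -> : y * z = ((X * (N - 1)) ^+ 2 - r ^+ 2) / (4 * N ^+ 2 * (4 - X) ^+ 2).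
    by rewrite /y /z; field; rewrite ?d0 ?N0 ?two_neq0 ?four0.
  by rewrite -rE; field; rewrite ?d0 ?N0 ?four0.
have x0 : x != 0 by rewrite mulf_neq0 ?invr_eq0 ?mulf_neq0.
have : y * z != 0.
  by rewrite yzP !mulf_neq0 ?invr_eq0 ?oppr_eq0 ?mulf_neq0 ?expf_neq0.
rewrite mulf_eq0 negb_or => /andP[y0 z0].
have s1 : x + y + z = 1 by rewrite -addrA yzS /x; field; rewrite ?d0 ?N0.
have s2 : x^-1 + y^-1 + z^-1 = N.
  have -> : x^-1 + y^-1 + z^-1 = x^-1 + (y + z) / (y * z).
    by field; rewrite ?x0 ?y0 ?z0.
  by rewrite yzS yzP /x; field; rewrite ?d0 ?d1 ?N0 ?oppr_eq0 ?X0 ?four0.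
clear yzS yzP; clearbody x y z.
rewrite (_ : v = vec2 (a * x) (a * x)^-1 + vec2 (a * y) (a * y)^-1 + vec2 (a * z) (a * z)^-1); last first.
  rewrite vE; apply: rV2P; rewrite !mxE /=; first by rewrite -!mulrDr s1 mulr1.
  by rewrite !invfM -!mulrDr s2 /N mulKf.
by apply: short_sum3; apply: hyperbola_vec2; rewrite mulf_neq0.
Qed.

(** Two points of the hyperbola with opposite second coordinates are opposite, so their sum is 0. *)
Lemma hyperbola_not_cover : ~ short_sum (mem hyperbola) 2 (vec2 1 0 : 'rV[F]_2).
Proof.
have coord (v w : 'rV[F]_2) : v = w -> v 0 0 = w 0 0 /\ v 0 1 = w 0 1 by move=> ->.
case/short_sumP2=> [/coord []|/hyperbolaP|[x [y [/hyperbolaP hx /hyperbolaP hy /coord []]]]].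
- by rewrite !mxE /= => /eqP; rewrite oner_eq0.
- by rewrite !mxE /= mulr0 => /eqP; rewrite eq_sym oner_eq0.
rewrite !mxE /= => e0 e1.
have e2 : x 0 0 = - y 0 0.
  have : x 0 0 * y 0 0 * (x 0 1 + y 0 1) = y 0 0 * (x 0 0 * x 0 1) + x 0 0 * (y 0 0 * y 0 1).
    by ring.
  by rewrite -e1 hx hy mulr0 !mulr1 => /esym/eqP; rewrite addrC addr_eq0 => /eqP.
by move/eqP: e0; rewrite e2 addNr oner_eq0.
Qed.

(* The curve x + y + z = 1/x + 1/y + 1/z = 3 is a cubic with a node at
   (1, 1, 1), hence rational. *)
Lemma hyperbola_triple : exists u x y z, [/\ u \in hyperbola, x \in hyperbola,
  y \in hyperbola & z \in hyperbola] /\ [/\ u *+ 3 = x + y + z, x != u & x != - u].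
Proof.
(* Only primes up to 13 divide the numbers used; 26 and 44 are [35 (1 - x)] and [35 (1 + x)]. *)
have f35 : (35 : F) != 0 by rewrite -[35]/(5 * 7)%:R natrM mulf_neq0 ?natF.
have f26 : (26 : F) != 0 by rewrite -[26]/(2 * 13)%:R natrM mulf_neq0 ?natF.
have f44 : (44 : F) != 0 by rewrite -[44]/(4 * 11)%:R natrM mulf_neq0 ?natF.
have f18 : (18 : F) != 0 by rewrite -[18]/(3 * 6)%:R natrM mulf_neq0 ?natF.
have [f5 f6 f7 f9] : [/\ (5 : F) != 0, (6 : F) != 0, (7 : F) != 0 & (9 : F) != 0].
  by split; apply: natF.
pose x : F := 9 / 35; pose y : F := - 6 / 7; pose z : F := 18 / 5.
have [x0 y0 z0] : [/\ x != 0, y != 0 & z != 0].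
  by split; rewrite mulf_neq0 ?invr_eq0 ?oppr_eq0.
exists (vec2 1 1), (vec2 x x^-1), (vec2 y y^-1), (vec2 z z^-1); split; split.
- by rewrite inE !vec2E mulr1.
- exact: hyperbola_vec2.
- exact: hyperbola_vec2.
- exact: hyperbola_vec2.
- apply: rV2P; rewrite !mxE /= /x /y /z; field;
    by rewrite ?f5 ?f6 ?f7 ?f9 ?f18 ?f35 ?oppr_eq0 ?f6.
- apply/eqP => /(congr1 (fun v : 'rV_2 => v 0 0)); rewrite !mxE /= => x1.
  move/eqP: f26; apply; have -> : 26 = 35 * (1 - x) by rewrite /x; field.
  by rewrite x1 subrr mulr0.
- apply/eqP => /(congr1 (fun v : 'rV_2 => v 0 0)); rewrite !mxE /= => x1.
  move/eqP: f44; apply; have -> : 44 = 35 * (1 + x) by rewrite /x; field.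
  by rewrite x1 subrr mulr0.
Qed.

End Hyperbola.

(** * The circle, for p = 7 mod 12 *)

Section Circle.
Variable F : finFieldType.
Hypothesis two_neq0 : (2 : F) != 0.
Hypothesis three_neq0 : (3 : F) != 0.
Hypothesis five_neq0 : (5 : F) != 0.
Hypothesis thirteen_neq0 : (13 : F) != 0.
Hypothesis chiN1 : chi (- 1 : F) = - 1.
Hypothesis chi3 : chi (3 : F) = - 1.

Definition circle : {set 'rV[F]_2} := [set v : 'rV[F]_2 | v 0 0 ^+ 2 + v 0 1 ^+ 2 == 1].

Let four_neq0 : (4 : F) != 0.
Proof. by rewrite -[4]/(2 * 2)%:R natrM mulf_neq0. Qed.

Lemma circleP (v : 'rV[F]_2) : reflect (v 0 0 ^+ 2 + v 0 1 ^+ 2 = 1) (v \in circle).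
Proof. by rewrite inE; apply: eqP. Qed.

Lemma circleN : {in circle, forall v, - v \in circle}.
Proof. by move=> v; rewrite !inE !mxE !sqrrN. Qed.

Lemma card_circleE : #|circle| = #|F|.+1.
Proof.
rewrite /circle (card_rV2 (fun a b : F => a ^+ 2 + b ^+ 2 == 1)).
by have := card_circle two_neq0; rewrite chiN1 opprK addrC => -[].
Qed.

(** The form is anisotropic because -1 is not a square. *)
Lemma norm2_eq0 (a b : F) : a ^+ 2 + b ^+ 2 = 0 -> a = 0 /\ b = 0.
Proof.
move=> ab; have [b0|b0] := eqVneq b 0.
  by move/eqP: ab; rewrite b0 expr0n addr0 sqrf_eq0 => /eqP.
case: (@chi_eqN1 F (- 1) (a / b)) => //.
have -> : (a / b) ^+ 2 = (a ^+ 2 + b ^+ 2) / b ^+ 2 - 1 by field.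
by rewrite ab mul0r add0r.
Qed.

(** For [N] the norm of [x + y] and [D] the determinant, Lagrange's identity gives
    [N (4 - N) = (2 D)^2]; both 1 and 3 turn the left side into 3. *)
Lemma circle_sum_norm (x y : 'rV[F]_2) : x \in circle -> y \in circle ->
  (x + y) 0 0 ^+ 2 + (x + y) 0 1 ^+ 2 != 1 /\ (x + y) 0 0 ^+ 2 + (x + y) 0 1 ^+ 2 != 3.
Proof.
move=> /circleP hx /circleP hy; rewrite !mxE.
set N := _ + _; pose D := x 0 0 * y 0 1 - x 0 1 * y 0 0.
have NE : (2 * D) ^+ 2 = N * (4 - N).
  have -> : N = (x 0 0 ^+ 2 + x 0 1 ^+ 2) + (y 0 0 ^+ 2 + y 0 1 ^+ 2)
     + 2 * (x 0 0 * y 0 0 + x 0 1 * y 0 1) by rewrite /N; ring.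
  have -> : (2 * D) ^+ 2 = 4 * ((x 0 0 ^+ 2 + x 0 1 ^+ 2) * (y 0 0 ^+ 2 + y 0 1 ^+ 2)
     - (x 0 0 * y 0 0 + x 0 1 * y 0 1) ^+ 2) by rewrite /D; ring.
  by rewrite hx hy; ring.
by split; apply/eqP => N1; apply: (chi_eqN1 (y := 2 * D) chi3); rewrite NE N1; ring.
Qed.

Lemma circle_sum2 : {in circle & &, forall x y z, x + y <> z}.
Proof.
move=> x y z xC yC /circleP hz xyz; have [+ _] := circle_sum_norm xC yC.
by rewrite xyz hz eqxx.
Qed.

(** With [s = x + y] of nonzero norm, each summand has inner product half that norm with [s], and
    its determinant with [s] is known up to sign; these two numbers determine it. *)
Lemma circle_sum22 x y z t : x \in circle -> y \in circle ->
  z \in circle -> t \in circle -> x + y = z + t -> [\/ x + y = 0, x = z | x = t].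
Proof.
move=> /circleP hx /circleP hy /circleP hz /circleP ht e.
pose s0 := x 0 0 + y 0 0; pose s1 := x 0 1 + y 0 1.
have yE : y 0 0 = s0 - x 0 0 /\ y 0 1 = s1 - x 0 1 by split; rewrite /s0 /s1; ring.
have tE : t 0 0 = s0 - z 0 0 /\ t 0 1 = s1 - z 0 1.
  have := congr1 (fun v : 'rV_2 => v 0 0) e; have := congr1 (fun v : 'rV_2 => v 0 1) e.
  by rewrite !mxE /s0 /s1 => -> ->; split; ring.
have [yE0 yE1] := yE; have [tE0 tE1] := tE.
have [S0|S0] := eqVneq (s0 ^+ 2 + s1 ^+ 2) 0.
  by have [a0 b0] := norm2_eq0 S0; apply: Or31; apply: rV2P; rewrite !mxE.
have dot : x 0 0 * s0 + x 0 1 * s1 = z 0 0 * s0 + z 0 1 * s1.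
  apply: (mulfI two_neq0).
  have dot1 a b : 2 * (a * s0 + b * s1) = s0 ^+ 2 + s1 ^+ 2 + (a ^+ 2 + b ^+ 2)
    - ((s0 - a) ^+ 2 + (s1 - b) ^+ 2) by ring.
  by rewrite !dot1 -yE0 -yE1 -tE0 -tE1 hx hy hz ht.
have cross1 a b : (a * s1 - b * s0) ^+ 2
    = (a ^+ 2 + b ^+ 2) * (s0 ^+ 2 + s1 ^+ 2) - (a * s0 + b * s1) ^+ 2 by ring.
have : (x 0 0 * s1 - x 0 1 * s0) ^+ 2 == (z 0 0 * s1 - z 0 1 * s0) ^+ 2.
  by rewrite !cross1 hx hz dot.
have coord (a b c d : F) : a * s0 + b * s1 = c * s0 + d * s1 ->
    a * s1 - b * s0 = c * s1 - d * s0 -> a = c /\ b = d.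
  move=> h1 h2; split; apply: (mulfI S0).
    have E u v : (s0 ^+ 2 + s1 ^+ 2) * u = (u * s0 + v * s1) * s0 + (u * s1 - v * s0) * s1 by ring.
    by rewrite (E a b) (E c d) h1 h2.
  have E u v : (s0 ^+ 2 + s1 ^+ 2) * v = (u * s0 + v * s1) * s1 - (u * s1 - v * s0) * s0 by ring.
  by rewrite (E a b) (E c d) h1 h2.
rewrite eqf_sqr => /orP[]/eqP cross.
  by have [h0 h1] := coord _ _ _ _ dot cross; apply: Or32; apply: rV2P.
have dott : t 0 0 * s0 + t 0 1 * s1 = x 0 0 * s0 + x 0 1 * s1.
  have -> : t 0 0 * s0 + t 0 1 * s1 = s0 ^+ 2 + s1 ^+ 2 - (z 0 0 * s0 + z 0 1 * s1).
    by rewrite tE0 tE1; ring.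
  rewrite -dot; apply: (mulfI two_neq0).
  have -> : 2 * (s0 ^+ 2 + s1 ^+ 2 - (x 0 0 * s0 + x 0 1 * s1)) = 2 * (x 0 0 * s0 + x 0 1 * s1)
     + 2 * ((s0 - x 0 0) ^+ 2 + (s1 - x 0 1) ^+ 2 - (x 0 0 ^+ 2 + x 0 1 ^+ 2)) by ring.
  by rewrite -yE0 -yE1 hx hy subrr mulr0 addr0.
have crosst : t 0 0 * s1 - t 0 1 * s0 = x 0 0 * s1 - x 0 1 * s0.
  by rewrite cross tE0 tE1; ring.
by have [h0 h1] := coord _ _ _ _ dott crosst; apply: Or33; apply: rV2P.
Qed.

(** A unit vector [x] with inner product [c] with [v] exists when [N - c^2] is a square. The rest
    [w] has norm [M = N + 1 - 2 c] and splits into [w / 2] plus and minus [k] times the rotated [w],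
    of norm 1 when [M (4 - M)] is a suitable square; [conic_pair] supplies [c]. *)
Lemma circle_cover v : short_sum (mem circle) 3 v.
Proof.
have [->|v0] := eqVneq v 0; first exact: short_sum0.
pose a := v 0 0; pose b := v 0 1; pose N := a ^+ 2 + b ^+ 2.
have N0 : N != 0.
  apply: contra_neq v0 => /norm2_eq0 [a0 b0].
  by apply: rV2P; rewrite !mxE.
have [c [M0 /is_squareP [mu muE] /is_squareP [nu nuE]]] := conic_pair two_neq0 chiN1 N0.
set M := N + 1 - 2 * c in M0 nuE.
pose x0 := (c * a - mu * b) / N; pose x1 := (c * b + mu * a) / N.
have xN : x0 ^+ 2 + x1 ^+ 2 = 1.
  have -> : x0 ^+ 2 + x1 ^+ 2 = (c ^+ 2 + mu ^+ 2) / N by rewrite /x0 /x1 /N; field.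
  by rewrite -muE addrC subrK divff.
pose w0 := a - x0; pose w1 := b - x1.
have wN : w0 ^+ 2 + w1 ^+ 2 = M.
  have -> : w0 ^+ 2 + w1 ^+ 2 = N + (x0 ^+ 2 + x1 ^+ 2) - 2 * (a * x0 + b * x1).
    by rewrite /w0 /w1 /N; ring.
  have -> : a * x0 + b * x1 = c by rewrite /x0 /x1 /N; field.
  by rewrite xN.
pose k := nu / (2 * M).
have yN l : l ^+ 2 = k ^+ 2 -> (w0 / 2 - l * w1) ^+ 2 + (w1 / 2 + l * w0) ^+ 2 = 1.
  move=> lk; have -> : (w0 / 2 - l * w1) ^+ 2 + (w1 / 2 + l * w0) ^+ 2
    = (1 / 4 + l ^+ 2) * (w0 ^+ 2 + w1 ^+ 2) by field; rewrite ?two_neq0 ?four_neq0.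
  have -> : l ^+ 2 = nu ^+ 2 / (4 * M ^+ 2) by rewrite lk /k; field; rewrite ?two_neq0 ?four_neq0 ?M0.
  by rewrite wN -nuE; field; rewrite ?four_neq0 ?M0.
have -> : v = vec2 x0 x1 + vec2 (w0 / 2 - k * w1) (w1 / 2 + k * w0)
   + vec2 (w0 / 2 - (- k) * w1) (w1 / 2 + (- k) * w0).
  by apply: rV2P; rewrite !mxE /= -/a -/b /w0 /w1; field.
by apply: short_sum3; apply/circleP; rewrite !vec2E // yN // sqrrN.
Qed.

(** Any vector of norm 3 will do, by [circle_sum_norm]. If 2 is a square, [3 = 1 + 2] gives one;
    otherwise 6 is a square and both coordinates can be half its root. *)
Lemma circle_not_cover : exists v, ~ short_sum (mem circle) 2 v.
Proof.
have [v vN] : exists v : 'rV[F]_2, v 0 0 ^+ 2 + v 0 1 ^+ 2 = 3.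
  have [|chi2] := eqVneq (chi (2 : F)) (- 1); last first.
    have [s sE] := chi_neqN1 chi2; exists (vec2 1 s).
    by rewrite !vec2E -sE; ring.
  move=> chi2; have [|s sE] := @chi_neqN1 F (2 * 3); first by rewrite chiM // chi2 chi3.
  exists (vec2 (s / 2) (s / 2)); rewrite !vec2E.
  have -> : (s / 2) ^+ 2 + (s / 2) ^+ 2 = s ^+ 2 / 2 by field.
  by rewrite -sE; field.
exists v => /short_sumP2 [v0|/circleP vC|[x [y [xC yC vE]]]].
- by move/eqP: vN; rewrite v0 !mxE expr0n addr0 eq_sym (negPf three_neq0).
- have : (2 : F) = 3 - 1 by ring.
  by rewrite -vN vC subrr => /eqP; rewrite (negPf two_neq0).
- by have [_ /eqP[]] := circle_sum_norm xC yC; rewrite -vE.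
Qed.

(* Subtracting from (3, 0) a unit vector (a, b) with 3 (a - 1) (5 - 3 a) a
   square leaves a sum of two unit vectors; -3 is a square here. *)
Lemma circle_triple : exists u x y z, [/\ u \in circle, x \in circle,
  y \in circle & z \in circle] /\ [/\ u *+ 3 = x + y + z, x != u & x != - u].
Proof.
have [r rE] : exists r : F, - 3 = r ^+ 2.
  by apply: chi_neqN1; rewrite -mulN1r chiM // chiN1 chi3.
have f25 : (25 : F) != 0 by rewrite -[25]/(5 * 5)%:R natrM mulf_neq0.
have f12 : (12 : F) != 0 by rewrite -[12]/(4 * 3)%:R natrM mulf_neq0.
(* The choice [(a, b) = (5/13, 12/13)] leaves [(34/13, -12/13)], of norm 100/13: its half plus and
   minus [e] times [(12/13, 34/13)] has norm 1 when [e^2 = 13/100 - 1/4 = -3/25]. *)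
pose y (e : F) := vec2 ((17 + 12 * e) / 13) ((- 6 + 34 * e) / 13).
have yC e : e ^+ 2 = - 3 / 25 -> y e \in circle.
  move=> eE; apply/circleP; rewrite !vec2E.
  have -> : ((17 + 12 * e) / 13) ^+ 2 + ((- 6 + 34 * e) / 13) ^+ 2
    = (25 + 100 * e ^+ 2) / 13 by field.
  by rewrite eE; field; rewrite ?f25 ?thirteen_neq0.
exists (vec2 1 0), (vec2 (5 / 13) (12 / 13)), (y (r / 5)), (y (- (r / 5))); split; split.
- by apply/circleP; rewrite !vec2E expr0n expr1n addr0.
- by apply/circleP; rewrite !vec2E; field; rewrite ?thirteen_neq0.
- by apply: yC; rewrite rE; field; rewrite ?f25 ?five_neq0.
- by apply: yC; rewrite sqrrN rE; field; rewrite ?f25 ?five_neq0.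
- by apply: rV2P; rewrite !mxE /=; field; rewrite ?five_neq0 ?thirteen_neq0.
- apply/eqP => /(congr1 (fun v : 'rV_2 => v 0 1)); rewrite !mxE /= => /eqP.
  by rewrite mulf_eq0 invr_eq0 (negPf f12) (negPf thirteen_neq0).
- apply/eqP => /(congr1 (fun v : 'rV_2 => v 0 1)); rewrite !mxE /= oppr0 => /eqP.
  by rewrite mulf_eq0 invr_eq0 (negPf f12) (negPf thirteen_neq0).
Qed.

End Circle.

Theorem theorem1 (p n : nat) (m : int)
  (p_prime : prime p) (p_ge7 : (7 <= p)%N)
  (p_mod12 : (p%:Z = 5 %[mod 12])%Z \/ (p%:Z = - 5 %[mod 12])%Z)
  (m_closest : closest_int (p%:R / 4%:R) m) (n_def : n%:Z = 2 * m) :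
  exists C : {set 'rV['F_p]_n},
    [/\ linear_code C, quasi_perfect C 2 & #|C| = (p ^ (n - 2))%N].
Proof.
have cardp : #|'F_p| = p by rewrite card_Fp.
have natF k : (0 < k < p)%N -> (k%:R : 'F_p) != 0.
  move=> /andP[k0 kp]; rewrite -(dvdn_pcharf (pchar_Fp p_prime)).
  by apply: contraL kp => /(dvdn_leq k0); rewrite leqNgt.
have three0 : (3 : 'F_p) != 0 by apply: natF; lia.
have two0 : (2 : 'F_p) != 0 by apply: natF; lia.
have dist (k : int) : `|p%:Z - 4 * m| <= `|p%:Z - 4 * k|.
  have := m_closest k.
  have E (l : int) : p%:R / 4%:R - l%:~R = (p%:Z - 4 * l)%:~R / 4 :> rat.
    by rewrite rmorphB rmorphM /= -pmulrn; field.
  by rewrite !E !normrM ler_pM2r // -!intr_norm ler_int.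
have pmod : (p %% 12 = 5 \/ p %% 12 = 7)%N by case: p_mod12; lia.
case: pmod => p12.
  have chiN1 : chi (- 1 : 'F_p) = 1 by apply: chiN1_mod4_1; rewrite // cardp; lia.
  have chi3 : chi (3 : 'F_p) = - 1.
    by rewrite -[3]opprK -[- - 3]mulN1r chiM // chiN1 mul1r chiN3_mod3_2 // cardp; lia.
  (* The least [p >= 7] that is 5 mod 12 is 17. *)
  have natF17 k : (0 < k < 17)%N -> (k%:R : 'F_p) != 0.
    by move=> k17; apply: natF; lia.
  (* Here [m = (p - 1) / 4], so [2 n = p - 1]. *)
  have nE : #|hyperbola 'F_p| = n.*2.
    by rewrite card_hyperbolaE // cardp; have := dist (p %/ 4)%N; lia.
  apply: (quasi_perfect_code _ _ nE) => //; first by lia.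
  - exact: hyperbolaN.
  - exact: hyperbola_sum2.
  - exact: hyperbola_sum22.
  - by apply: hyperbola_cover; rewrite // cardp; lia.
  - by exists (vec2 1 0); apply: hyperbola_not_cover.
  - exact: hyperbola_triple.
have chiN1 : chi (- 1 : 'F_p) = - 1 by apply: chiN1_mod4_3; rewrite // cardp; lia.
have chi3 : chi (3 : 'F_p) = - 1.
  by rewrite -[3]opprK -[- - 3]mulN1r chiM // chiN1 chiN3_mod3_1 // cardp; lia.
(* [p] may be 7, so size alone does not decide; but 13 is 1 mod 12. *)
have thirteen0 : (13 : 'F_p) != 0.
  rewrite -(dvdn_pcharf (pchar_Fp p_prime)) dvdn_prime2 //.
  by apply/eqP => p13; move: p12; rewrite p13.
(* Here [m = (p + 1) / 4], so [2 n = p + 1]. *)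
have nE : #|circle 'F_p| = n.*2.
  by rewrite card_circleE // cardp; have := dist (p %/ 4).+1; lia.
apply: (quasi_perfect_code _ _ nE) => //; first by lia.
- exact: circleN.
- exact: circle_sum2.
- exact: circle_sum22.
- exact: circle_cover.
- exact: circle_not_cover.
- by apply: circle_triple => //; apply: natF; lia.
Qed.
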